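(* Let $A$ be an $m\times n$ sensing matrix and let $\mathcal{S}$ be a representation structure with $B=I_n$ and $\|\cdot\|_{(k)}=\|\cdot\|_2$, $1\le k\le K$; let $A=[A[1],\dots,A[K]]$, $A[k]\in\mathbb{R}^{m\times n_k}$, be the corresponding partition of $A$. Let $s\le K$ be a positive integer. (i) Let $\mu$ be the mutual block-incoherence of $A$ w.r.t. $\mathcal{S}$. Assuming $\mu<\infty$, set $$H=\frac{1}{1+\mu}\big[A[1]C_1^{-1},A[2]C_2^{-1},\dots,A[K]C_K^{-1}\big],\qquad C_k=A^T[k]A[k].$$ Then the matrix $H$ along with the matrix $V=I_n-H^TA$, partitioned as $V=[V^{k\ell}\in\mathbb{R}^{n_k\times n_\ell}]_{k,\ell=1}^K$, satisfies $I_n=V+H^TA$ and $$\max_{1\le k,\ell\le K}\sigma_{\max}(V^{k\ell})\le s^{-1}\kappa\qquad\text{with}\quad\kappa=\frac{\mu s}{1+\mu}.$$ As a result, whenever $$s<\frac{1+\mu}{2\mu},$$ the pair $(H,L_\infty(\cdot))$ satisfies $\mathbf{Q}_{s,\infty}(\kappa)$ with $\kappa=\frac{\mu s}{1+\mu}<1/2$. (ii) Suppose that $n_k=d$, $k=1,\dots,K$, that the columns of $A$ are of unit $\|\cdot\|_2$-norm, and let the quantities $$\nu=\max_{1\le k\le K}\ \max_{1\le j\ne j'\le d}\big|\mathrm{Col}_j^T[A[k]]\,\mathrm{Col}_{j'}[A[k]]\big|,\qquad\mu_B=\frac1d\max_{\substack{1\le k,\ell\le K\\k\ne\ell}}\sigma_{\max}(A^T[k]A[\ell])$$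 satisfy the relations $$1-(d-1)\nu>0\qquad\text{and}\qquad s<\chi:=\frac{1-(d-1)\nu+d\mu_B}{2d\mu_B}.$$ Then the mutual block-incoherence $\mu$ of $A$ w.r.t. $\mathcal{S}$ does not exceed $\bar\mu=\frac{d\mu_B}{1-(d-1)\nu}$. Furthermore, $\frac{1+\bar\mu}{2\bar\mu}=\chi$, and $s<\frac{1+\mu}{2\mu}$ holds, which ensures that the matrix $H$ defined in (i), together with $L_\infty(\cdot)$, satisfies $\mathbf{Q}_{s,\infty}(\kappa)$ with some $\kappa<\frac12$.
   Context: Vectors $w\in\mathbb{R}^n$ ($n=n_1+\cdots+n_K$) are split into blocks $w=[w[1];\dots;w[K]]$, $w[k]\in\mathbb{R}^{n_k}$. For $1\le p\le\infty$, $L_p(w)=\|[\|w[1]\|_2;\dots;\|w[K]\|_2]\|_p$; $w^s$ is obtained from $w$ by zeroing out all but the $s$ blocks largest in $\|\cdot\|_2$ norm; $L_{s,p}(w)=L_p(w^s)$. Condition $\mathbf{Q}_{s,\infty}(\kappa)$ (associated with $A$ and this r.s.): a pair $(H,\|\cdot\|)$, $H\in\mathbb{R}^{m\times M}$, $\|\cdot\|$ a norm on $\mathbb{R}^M$, satisfies it if $L_{s,\infty}(x)\le\|H^TAx\|+\kappa s^{-1}L_1(x)$ for all $x\in\mathbb{R}^n$. The mutual block-incoherence of $A$ w.r.t. the r.s. is $$\mu=\max_{1\le k,\ell\le K,\ k\ne\ell}\sigma_{\max}\big(C_k^{-1}A^T[k]A[\ell]\big),\qquad C_k:=A^T[k]A[k],$$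 provided all matrices $C_k$, $1\le k\le K$, are nonsingular; otherwise $\mu=\infty$. $\sigma_{\max}$ denotes the largest singular value (spectral norm), $\mathrm{Col}_j[M]$ the $j$th column of $M$. Conventions: a maximum over an empty set is $0$; fractions $\frac{1+\mu}{2\mu}$, $\frac{1+\bar\mu}{2\bar\mu}$, $\chi$ with zero denominator are $+\infty$. *)

(* Defs.v *)
From HB Require Import structures.
From mathcomp Require Import all_boot all_order all_algebra.
From mathcomp Require Import all_classical all_reals all_analysis.

Set Implicit Arguments.
Unset Strict Implicit.
Unset Printing Implicit Defensive.

Import Order.TTheory GRing.Theory Num.Theory.

Local Open Scope classical_set_scope.
Local Open Scope ring_scope.

Definition norm2 (R : realType) (n : nat) (x : 'cV[R]_n) : R :=
  Num.sqrt (\sum_(i < n) x i 0 ^+ 2).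

Definition is_norm (R : realType) (n : nat) (N : 'cV[R]_n -> R) : Prop :=
  [/\ forall x y, N (x + y) <= N x + N y,
      forall a x, N (a *: x) = `|a| * N x
    & forall x, N x = 0 -> x = 0].

(* The l_p norm of u in R^K, for p in [1, +oo]; the value at -oo is junk. *)
Definition lp_norm (R : realType) (K : nat) (p : \bar R) (u : 'I_K -> R) : R :=
  match p with
  | r%:E => (\sum_(k < K) `|u k| `^ r) `^ r^-1
  | _ => \big[Num.max/0]_(k < K) `|u k|
  end.

(* Singular values of M are the square roots of the eigenvalues of M^T M.  The
   set below is finite, so its supremum is its maximum; it is empty only for a
   matrix without columns, for which [sup] returns 0. *)
Definition sigma_max (R : realType) (p q : nat) (M : 'M[R]_(p, q)) : R :=
  sup [set t : R | 0 <= t /\ eigenvalue (M^T *m M) (t ^+ 2)].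

Section Blocks.
Variables (R : realType) (K : nat) (n_ : 'I_K -> nat).
Local Notation n := (\sum_(k < K) n_ k)%N.

Implicit Types (w x : 'cV[R]_n) (s : nat).

Definition block w (k : 'I_K) : 'cV[R]_(n_ k) := submxcol w k.

Definition L (p : \bar R) w : R := lp_norm p (fun k => norm2 (block w k)).

(* Sorting is stable: ties between blocks of equal norm are broken in favour
   of the smaller index.  The value of [Ls] does not depend on this choice. *)
Definition largest_blocks s w : seq 'I_K :=
  take s (sort (fun k l => norm2 (block w l) <= norm2 (block w k))
               (enum 'I_K)).

Definition truncate s w : 'cV[R]_n :=
  \mxcol_(k < K) (if k \in largest_blocks s w then block w k else 0).

Definition Ls s (p : \bar R) w : R := L p (truncate s w).

Definition condQ (m M : nat) (A : 'M[R]_(m, n)) s (kappa : R)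
    (H : 'M[R]_(m, M)) (N : 'cV[R]_M -> R) : Prop :=
  is_norm N /\
  forall x, Ls s +oo%E x <= N (H^T *m A *m x) + kappa * s%:R^-1 * L 1%:E x.

Section Coherence.
Variables (m : nat) (A : 'M[R]_(m, n)).

Definition colblock (k : 'I_K) : 'M[R]_(m, n_ k) := submxrow A k.

Definition gram (k : 'I_K) : 'M[R]_(n_ k) := (colblock k)^T *m colblock k.

(* All maxima below are of nonnegative numbers, so starting them at 0 only
   fixes the value of the empty maximum. *)
Definition block_incoherence : \bar R :=
  if [forall k, gram k \in unitmx] then
    (\big[Num.max/0]_(k < K) \big[Num.max/0]_(l < K | k != l)
       sigma_max (invmx (gram k) *m (colblock k)^T *m colblock l))%:E
  else +oo%E.

Definition contrast (mu : R) : 'M[R]_(m, n) :=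
  (1 + mu)^-1 *: \mxrow_(k < K) (colblock k *m invmx (gram k)).

Definition sub_coherence : R :=
  \big[Num.max/0]_(k < K)
    \big[Num.max/0]_(j < n_ k) \big[Num.max/0]_(j' < n_ k | j != j')
      `|((col j (colblock k))^T *m col j' (colblock k)) 0 0|.

Definition block_coherence (d : nat) : R :=
  d%:R^-1 * \big[Num.max/0]_(k < K) \big[Num.max/0]_(l < K | k != l)
    sigma_max ((colblock k)^T *m colblock l).

End Coherence.

End Blocks.

Definition efrac (R : realType) (a b : R) : \bar R :=
  if b == 0 then +oo%E else (a / b)%:E.

(* Main.v *)
Require Import Defs.
From HB Require Import structures.
From mathcomp Require Import all_boot all_order all_algebra.
From mathcomp Require Import all_classical all_reals all_analysis.
From mathcomp Require Import ring lra.

(** Why the theorem holds.  With the columns of H built from A[k] C_k^-1, the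
    block (k, l) of H^T A is C_k^-1 A[k]^T A[l] / (1 + mu): an identity divided
    by 1 + mu when k = l, a matrix of spectral norm at most mu / (1 + mu)
    otherwise.  The scaling 1 / (1 + mu) is the one that balances the two cases:
    the diagonal blocks of V = I - H^T A are mu / (1 + mu) times the identity,
    so all blocks of V have spectral norm at most mu / (1 + mu)
    ([sigma_max_contrast_residual]).  Writing x = H^T A x + V x and taking the
    norm of each block gives condition Q ([condQ_of_blocks]).

    For the second part, unit columns and off-diagonal entries at most nu make
    the Gram matrices C_k coercive with constant 1 - (d - 1) nu
    ([near_identity_coercive]), so the inverse of C_k has norm at most
    1 / (1 - (d - 1) nu), and the incoherence is at most mubar
    ([block_incoherence_le]).  The rest is arithmetic with fractions, as
    (1 + mu) / (2 mu) decreases with mu.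

    Both parts use sigma_max as an operator norm, while it is defined from the
    eigenvalues of M^T M.  That eigenvalues are at most the operator norm is
    immediate.  Conversely, let lam be the infimum of the l such that
    |M x|^2 <= l |x|^2 for all x.  If lam were not an eigenvalue, the positive
    semidefinite matrix lam I - M^T M would be invertible, hence bounded below
    by a positive multiple of the identity, and lam could be decreased
    ([mulmx_strictly_bounded]); so sqrt lam is one of the singular values
    ([mulmx_sigma_max]). *)

Set Implicit Arguments.
Unset Strict Implicit.
Unset Printing Implicit Defensive.

Import Order.TTheory GRing.Theory Num.Theory.

Local Open Scope ring_scope.

(** * Euclidean norm *)

Definition dot (R : realType) (n : nat) (x y : 'cV[R]_n) : R :=
  (x^T *m y) 0 0.

Section Euclidean.
Variables (R : realType) (n : nat).
Implicit Types (x y : 'cV[R]_n) (a : R).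

Lemma dotE x y : dot x y = \sum_i x i 0 * y i 0.
Proof. by rewrite /dot mxE; apply: eq_bigr => i _; rewrite mxE. Qed.

Lemma dotC x y : dot x y = dot y x.
Proof. by rewrite !dotE; apply: eq_bigr => i _; rewrite mulrC. Qed.

Lemma dotDr x y z : dot x (y + z) = dot x y + dot x z.
Proof. by rewrite /dot mulmxDr mxE. Qed.

Lemma dotZr a x y : dot x (a *: y) = a * dot x y.
Proof. by rewrite /dot -scalemxAr mxE. Qed.

Lemma dotDl x y z : dot (x + y) z = dot x z + dot y z.
Proof. by rewrite dotC dotDr !(dotC z). Qed.

Lemma dotZl a x y : dot (a *: x) y = a * dot x y.
Proof. by rewrite dotC dotZr dotC. Qed.

Lemma norm2_ge0 x : 0 <= norm2 x.
Proof. exact: sqrtr_ge0. Qed.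

Lemma norm2_sq x : norm2 x ^+ 2 = dot x x.
Proof.
rewrite sqr_sqrtr ?sumr_ge0 // => [|i _]; last exact: sqr_ge0.
by rewrite dotE; apply: eq_bigr => i _; rewrite expr2.
Qed.

Lemma norm2_eq0 x : (norm2 x == 0) = (x == 0).
Proof.
apply/eqP/eqP => [x0|->]; last first.
  by rewrite /norm2 big1 ?sqrtr0 // => i _; rewrite mxE expr0n.
have: \sum_(i < n) x i 0 ^+ 2 == 0.
  rewrite eq_le -sqrtr_eq0 -/(norm2 x) x0 eqxx /=.
  by apply: sumr_ge0 => i _; exact: sqr_ge0.
rewrite psumr_eq0 => [/allP h|i _]; last exact: sqr_ge0.
apply/matrixP => i j; rewrite mxE ord1; apply/eqP.
by have := h i (mem_index_enum _); rewrite implyTb sqrf_eq0.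
Qed.

Lemma norm2_0 : norm2 (0 : 'cV[R]_n) = 0.
Proof. by apply/eqP; rewrite norm2_eq0. Qed.

Lemma norm2_gt0 x : (0 < norm2 x) = (x != 0).
Proof. by rewrite lt_def norm2_ge0 andbT norm2_eq0. Qed.

Lemma norm2Z a x : norm2 (a *: x) = `|a| * norm2 x.
Proof.
rewrite -sqrtr_sqr -sqrtrM ?sqr_ge0 // mulr_sumr /norm2.
by congr Num.sqrt; apply: eq_bigr => i _; rewrite mxE exprMn.
Qed.

Lemma norm2N x : norm2 (- x) = norm2 x.
Proof. by rewrite -scaleN1r norm2Z normrN1 mul1r. Qed.

(** Cauchy-Schwarz, from the nonnegativity of the squared norm of
    |y| x - |x| y. *)
Lemma dot_norm2_le x y : dot x y <= norm2 x * norm2 y.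
Proof.
have [->|] := eqVneq y 0.
  by rewrite /dot mulmx0 mxE mulr_ge0 ?norm2_ge0.
rewrite -norm2_gt0 => y0.
have [->|] := eqVneq x 0.
  by rewrite dotC /dot mulmx0 mxE mulr_ge0 ?norm2_ge0.
rewrite -norm2_gt0 => x0.
have := sqr_ge0 (norm2 (norm2 y *: x - norm2 x *: y)).
rewrite norm2_sq -scaleNr !dotDl !dotDr !dotZl !dotZr -!norm2_sq (dotC y x).
move: x0 y0; set a := norm2 x; set b := norm2 y; set c := dot x y => x0 y0 h.
have {}h : 0 <= (a * b) * (a * b - c) by nra.
by rewrite -subr_ge0 -(pmulr_rge0 _ (mulr_gt0 x0 y0)).
Qed.

Lemma norm2D x y : norm2 (x + y) <= norm2 x + norm2 y.
Proof.
rewrite -ler_sqr ?nnegrE ?addr_ge0 ?norm2_ge0 //.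
rewrite norm2_sq dotDl !dotDr -!norm2_sq (dotC y x).
have := dot_norm2_le x y; nra.
Qed.

Lemma norm2_sum (I : finType) (f : I -> 'cV[R]_n) :
  norm2 (\sum_i f i) <= \sum_i norm2 (f i).
Proof.
elim/big_rec2: _ => [|i a v _ h]; first by rewrite norm2_0.
exact: le_trans (norm2D _ _) (lerD (lexx _) h).
Qed.

End Euclidean.

(** * The largest singular value as an operator norm *)

Section OperatorNorm.
Variable R : realType.

Lemma dot_mulmx p q (M : 'M[R]_(p, q)) x y : dot (M *m x) y = dot x (M^T *m y).
Proof. by rewrite /dot trmx_mul mulmxA. Qed.

(** Cauchy-Schwarz on each row bounds M by its Frobenius norm.  This crude
    constant makes the infimum and supremum in [mulmx_sigma_max] meaningful, and
    bounds the inverse in [mulmx_strictly_bounded]; the summand 1 keeps it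
    positive. *)
Lemma mulmx_bounded p q (M : 'M[R]_(p, q)) :
  exists2 C : R, 0 < C & forall x, norm2 (M *m x) ^+ 2 <= C * norm2 x ^+ 2.
Proof.
exists (1 + \sum_i norm2 (row i M)^T ^+ 2).
  by rewrite ltr_pwDl // sumr_ge0 // => i _; exact: sqr_ge0.
move=> x; rewrite mulrDl mul1r mulr_suml norm2_sq dotE.
apply: ler_wpDl; first exact: sqr_ge0.
apply: ler_sum => i _; rewrite -exprMn -expr2.
have -> : (M *m x) i 0 = dot (row i M)^T x.
  by rewrite /dot trmxK -row_mul [RHS]mxE.
rewrite -[leLHS]real_normK ?num_real // ler_sqr ?nnegrE ?mulr_ge0 ?norm2_ge0 //.
rewrite ler_norml dot_norm2_le andbT lerNl.
by have := dot_norm2_le (- (row i M)^T) x; rewrite norm2N -scaleN1r dotZl mulN1r.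
Qed.

Lemma eigenvalue_gram_le p q (M : 'M[R]_(p, q)) (c t : R) :
  0 <= c -> (forall x, norm2 (M *m x) <= c * norm2 x) ->
  0 <= t -> eigenvalue (M^T *m M) (t ^+ 2) -> t <= c.
Proof.
move=> c0 Mc t0 /eigenvalueP[v vE v0].
have v0' : 0 < norm2 v^T by rewrite norm2_gt0 trmx_eq0.
rewrite -(ler_pM2r v0'); apply: le_trans (Mc _).
rewrite -ler_sqr ?nnegrE ?mulr_ge0 ?norm2_ge0 //.
rewrite exprMn !norm2_sq dot_mulmx.
have -> : M^T *m (M *m v^T) = t ^+ 2 *: v^T.
  by rewrite -linearZ /= -vE !trmx_mul trmxK mulmxA.
by rewrite dotZr.
Qed.

Lemma sigma_max_le p q (M : 'M[R]_(p, q)) (c : R) :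
  0 <= c -> (forall x, norm2 (M *m x) <= c * norm2 x) -> sigma_max M <= c.
Proof.
move=> c0 Mc; rewrite /sigma_max; set S := [set _ | _]%classic.
have [->|S0] := eqVneq S set0; first by rewrite sup0.
apply: ge_sup; first exact/set0P.
by move=> t [t0]; exact: eigenvalue_gram_le.
Qed.

(** The positive semidefinite form Q = lam I - M^T M is bounded above by C |.|^2,
    so |Q x|^2 <= C <x, Q x>; when lam is not an eigenvalue, Q is invertible and
    |x|^2 <= D |Q x|^2 <= C D <x, Q x>, which is a gap between |M x|^2 and
    lam |x|^2. *)
Lemma mulmx_strictly_bounded p q (M : 'M[R]_(p, q)) (lam : R) :
  (forall x, norm2 (M *m x) ^+ 2 <= lam * norm2 x ^+ 2) ->
  ~~ eigenvalue (M^T *m M) lam ->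
  exists2 eps : R, 0 < eps &
    forall x, norm2 (M *m x) ^+ 2 <= (lam - eps) * norm2 x ^+ 2.
Proof.
move=> Mlam; rewrite /eigenvalue negbK kermx_eq0 row_free_unit.
set Q0 := _ - _ => Qu.
have QT : Q0^T = Q0 by rewrite /Q0 linearB /= trmx_mul trmxK tr_scalar_mx.
pose Q := - Q0.
have QE x : dot x (Q *m x) = lam * norm2 x ^+ 2 - norm2 (M *m x) ^+ 2.
  rewrite /Q /Q0 opprB mulmxBl mul_scalar_mx -scaleN1r dotDr dotZr dotZr.
  by rewrite !norm2_sq -mulmxA dot_mulmx mulN1r.
have Qge0 x : 0 <= dot x (Q *m x) by rewrite QE subr_ge0.
have Qsym x y : dot x (Q *m y) = dot y (Q *m x).
  by rewrite dotC dot_mulmx /Q linearN /= QT.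
pose C := `|lam| + 1.
have C0 : 0 < C by rewrite ltr_wpDl.
have QC y : dot y (Q *m y) <= C * norm2 y ^+ 2.
  rewrite QE; have := sqr_ge0 (norm2 (M *m y)); have := sqr_ge0 (norm2 y).
  have := ler_norm lam; rewrite /C; nra.
(* Nonnegativity of the form at x - Q x / C, the minimizer over z of the
   majorant <x, Q x> + 2 <Q x, z> + C |z|^2 of <x + z, Q (x + z)>. *)
have Qlow x : norm2 (Q *m x) ^+ 2 <= C * dot x (Q *m x).
  have := Qge0 (x + (- C^-1) *: (Q *m x)).
  rewrite mulmxDr -scalemxAr !dotDl !dotDr !dotZl !dotZr.
  rewrite (Qsym x (Q *m x)) -norm2_sq.
  have := QC (Q *m x); set u := dot (Q *m x) _; set v := dot x _.
  set w := norm2 _ ^+ 2 => h1 h2.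
  have : 0 <= C * (v + - C^-1 * w + - C^-1 * (w + - C^-1 * u)).
    by move: h2; rewrite pmulr_rge0 // !mulrDr.
  have -> : C * (v + - C^-1 * w + - C^-1 * (w + - C^-1 * u))
     = C * v - 2 * w + C^-1 * u by field; rewrite gt_eqF.
  have : C^-1 * u <= w by rewrite ler_pdivrMl.
  lra.
have [D D0 invD] := mulmx_bounded (invmx Q).
exists ((C * D)^-1); first by rewrite invr_gt0 mulr_gt0.
have Qunit : Q \in unitmx by rewrite /Q -scaleN1r unitmxZ // unitrN1.
move=> x; rewrite mulrBl lerBrDr addrC -lerBrDr -QE ler_pdivrMl ?mulr_gt0 //.
have := invD (Q *m x); rewrite mulKmx // => /le_trans; apply.
by rewrite (mulrC C) -mulrA ler_pM2l.
Qed.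

(** The best constant lam in |M x|^2 <= lam |x|^2 is an eigenvalue of M^T M,
    since otherwise it could be improved by [mulmx_strictly_bounded]. *)
Lemma mulmx_sigma_max p q (M : 'M[R]_(p, q)) x :
  norm2 (M *m x) <= sigma_max M * norm2 x.
Proof.
have [->|x0] := eqVneq x 0; first by rewrite mulmx0 !norm2_0 mulr0.
pose E := [set l : R | forall y, norm2 (M *m y) ^+ 2 <= l * norm2 y ^+ 2]%classic.
have Epos l : E l -> 0 <= l.
  move=> /(_ x) /(le_trans (sqr_ge0 _)).
  by rewrite pmulr_lge0 // exprn_gt0 // norm2_gt0.
have E0 : (E !=set0)%classic by have [C _ h] := mulmx_bounded M; exists C.
have Elb : has_lbound E by exists 0 => l /Epos.
pose lam := inf E.
have lam0 : 0 <= lam by apply: lb_le_inf => // l /Epos.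
have Elam : E lam.
  move=> y; have [->|y0] := eqVneq y 0; first by rewrite mulmx0 !norm2_0 expr0n mulr0.
  have yp : 0 < norm2 y ^+ 2 by rewrite exprn_gt0 // norm2_gt0.
  rewrite -ler_pdivrMr //; apply: lb_le_inf => // l /(_ y).
  by rewrite ler_pdivrMr.
have eig : eigenvalue (M^T *m M) lam.
  apply: contraT => /(mulmx_strictly_bounded Elam)[e e0 Ee].
  have : lam <= lam - e by apply: ge_inf.
  by rewrite lerBrDr gerDl leNgt e0.
have [C C0 MC] := mulmx_bounded M.
have lamM : Num.sqrt lam <= sigma_max M.
  apply: ub_le_sup; last by split; rewrite ?sqr_sqrtr // sqrtr_ge0.
  exists (Num.sqrt C) => t [t0]; apply: eigenvalue_gram_le => // y.
  rewrite -ler_sqr ?nnegrE ?mulr_ge0 ?norm2_ge0 ?sqrtr_ge0 //.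
  rewrite exprMn (sqr_sqrtr (ltW C0)); exact: MC.
apply: le_trans (ler_wpM2r (norm2_ge0 _) lamM).
rewrite -ler_sqr ?nnegrE ?mulr_ge0 ?norm2_ge0 ?sqrtr_ge0 //.
rewrite exprMn (sqr_sqrtr lam0); exact: Elam.
Qed.

End OperatorNorm.

(** * Block norms, condition Q and the contrast matrix *)

Section BlockNorms.
Variables (R : realType) (K : nat) (n_ : 'I_K -> nat).
Local Notation n := (\sum_(k < K) n_ k)%N.
Implicit Types (w x : 'cV[R]_n) (s : nat).

Lemma block_mulmx (V : 'M[R]_n) x k :
  block (V *m x) k = \sum_l submxblock V k l *m block x l.
Proof.
rewrite /block -submxcol_mul -{1}(submxrowK (submxcol V k)).
rewrite -{1}(submxcolK x) mul_mxrow_mxcol.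
by apply: eq_bigr => l _; rewrite submxblockEv.
Qed.

Lemma norm2_block_le w k : norm2 (block w k) <= L +oo%E w.
Proof.
apply: le_trans (ler_norm _) _.
exact: (le_bigmax _ (fun k => `|norm2 (block w k)|)).
Qed.

Lemma L_infty_ge0 w : 0 <= L +oo%E w.
Proof. exact: bigmax_ge_id. Qed.

Lemma L_infty_le w c :
  0 <= c -> (forall k, norm2 (block w k) <= c) -> L +oo%E w <= c.
Proof.
by move=> c0 h; apply: bigmax_le => // k _; rewrite ger0_norm ?norm2_ge0.
Qed.

Lemma L_1E w : L 1%:E w = \sum_k norm2 (block w k).
Proof.
rewrite /L /lp_norm invr1 powRr1; last first.
  by apply: sumr_ge0 => k _; exact: powR_ge0.
by apply: eq_bigr => k _; rewrite powRr1 // ger0_norm ?norm2_ge0.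
Qed.

Lemma L_infty_is_norm : is_norm (L (R := R) (n_ := n_) +oo%E).
Proof.
have blockZ a x k : norm2 (block (a *: x) k) = `|a| * norm2 (block x k).
  by rewrite -norm2Z; congr norm2; apply/matrixP => i j; rewrite !mxE.
split=> [x y|a x|x x0].
- apply: L_infty_le => [|k]; first by rewrite addr_ge0 ?L_infty_ge0.
  rewrite /block submxcolD; apply: le_trans (norm2D _ _) _.
  by apply: lerD; exact: norm2_block_le.
- apply: le_anti; apply/andP; split.
    apply: L_infty_le => [|k]; first by rewrite mulr_ge0 ?L_infty_ge0.
    by rewrite blockZ ler_wpM2l ?norm2_block_le.
  have [->|a0] := eqVneq a 0; first by rewrite normr0 mul0r L_infty_ge0.
  rewrite -ler_pdivlMl ?normr_gt0 //; apply: L_infty_le => [|k].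
    by rewrite mulr_ge0 ?invr_ge0 ?L_infty_ge0.
  by rewrite ler_pdivlMl ?normr_gt0 // -blockZ norm2_block_le.
rewrite -(submxcolK x) -(mxcol0 _); apply/eq_mxcol => k.
apply/eqP; rewrite -norm2_eq0 -/(block x k) eq_le norm2_ge0 andbT -x0.
exact: norm2_block_le.
Qed.

Lemma Ls_infty_le s x : Ls s +oo%E x <= L +oo%E x.
Proof.
apply: L_infty_le => [|k]; first exact: L_infty_ge0.
rewrite /block /truncate mxcolK; case: ifP => _; first exact: norm2_block_le.
by rewrite norm2_0 L_infty_ge0.
Qed.

(** A truncation only shrinks block norms, so the left-hand side of condition Q
    is at most the largest block norm of x = H^T A x + (I - H^T A) x; block k of
    the second term is the sum over l of the block (k, l) applied to x[l]. *)
Lemma condQ_of_blocks m (A H : 'M[R]_(m, n)) s (kappa : R) :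
  0 <= kappa ->
  (forall k l, sigma_max (submxblock (1%:M - H^T *m A) k l) <= s%:R^-1 * kappa) ->
  condQ A s kappa H (L (n_ := n_) +oo%E).
Proof.
move=> kappa0 Vle; split; first exact: L_infty_is_norm.
move=> x; apply: le_trans (Ls_infty_le s x) _.
have kL1 : 0 <= kappa * s%:R^-1 * L 1%:E x.
  rewrite L_1E mulr_ge0 ?mulr_ge0 ?invr_ge0 ?ler0n // sumr_ge0 // => k _.
  exact: norm2_ge0.
apply: L_infty_le => [|k]; first by rewrite addr_ge0 ?L_infty_ge0.
have xE : x = H^T *m A *m x + (1%:M - H^T *m A) *m x.
  by rewrite -mulmxDl addrC subrK mul1mx.
rewrite [in leLHS]xE /block submxcolD -!/(block _ _).
apply: le_trans (norm2D _ _) _; apply: lerD; first exact: norm2_block_le.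
rewrite block_mulmx L_1E mulr_sumr; apply: le_trans (norm2_sum _) _.
apply: ler_sum => l _; apply: le_trans (mulmx_sigma_max _ _) _.
by rewrite ler_wpM2r ?norm2_ge0 // mulrC.
Qed.

Section Contrast.
Variables (m : nat) (A : 'M[R]_(m, n)).

Lemma tr_gram k : (gram A k)^T = gram A k.
Proof. by rewrite /gram trmx_mul trmxK. Qed.

Lemma block_incoherence_fin :
  (block_incoherence A < +oo)%E -> forall k, gram A k \in unitmx.
Proof. by rewrite /block_incoherence; case: ifP => // /forallP. Qed.

Lemma block_incoherence_ge0 : 0 <= fine (block_incoherence A).
Proof.
by rewrite /block_incoherence; case: ifP => // _ /=; exact: bigmax_ge_id.
Qed.

Lemma sigma_max_le_incoherence k l :
  (block_incoherence A < +oo)%E -> k != l ->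
  sigma_max (invmx (gram A k) *m (colblock A k)^T *m colblock A l)
    <= fine (block_incoherence A).
Proof.
rewrite /block_incoherence; case: ifP => // _ _ kl /=.
apply: (bigmax_sup k) => //.
exact: (le_bigmax_cond _ (fun l =>
  sigma_max (invmx (gram A k) *m (colblock A k)^T *m colblock A l))).
Qed.

Lemma submxblock_contrast mu k l :
  submxblock ((contrast A mu)^T *m A) k l =
  (1 + mu)^-1 *: (invmx (gram A k) *m (colblock A k)^T *m colblock A l).
Proof.
rewrite submxblockEv -submxcol_mul -mul_submxrow -tr_submxrow.
have -> : submxrow (contrast A mu) k =
    (1 + mu)^-1 *: (colblock A k *m invmx (gram A k)).
  rewrite -[colblock A k *m _](mxrowK
    (fun k => colblock A k *m invmx (gram A k))).
  by apply/matrixP => i j; rewrite !mxE.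
by rewrite linearZ /= trmx_mul trmx_inv tr_gram -scalemxAl.
Qed.

Lemma submxblock_scalar (a : R) k l :
  submxblock (a%:M : 'M[R]_n) k l =
  if k == l then \matrix_(i, j) (a *+ (i == j :> nat)) else 0.
Proof.
apply/matrixP => i j; rewrite !mxE -val_eqE /= tagnat.eq_Rank.
by case: eqVneq => kl; rewrite !mxE.
Qed.

(** On the diagonal, 1 - 1 / (1 + mu) = mu / (1 + mu); off the diagonal, the
    definition of mu gives mu * (1 / (1 + mu)). *)
Lemma sigma_max_contrast_residual k l :
  let mu := fine (block_incoherence A) in
  (block_incoherence A < +oo)%E ->
  sigma_max (submxblock (1%:M - (contrast A mu)^T *m A) k l) <= mu / (1 + mu).
Proof.
move=> mu Afin; have mu0 : 0 <= mu := block_incoherence_ge0.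
have mu1 : 0 < 1 + mu by rewrite ltr_pwDl.
have c0 : 0 <= mu / (1 + mu) by rewrite divr_ge0 // ltW.
apply: sigma_max_le => // x.
rewrite submxblockB submxblock_contrast submxblock_scalar.
have [kl|kl] := eqVneq k l.
  subst l; rewrite -(mulmxA (invmx _)) mulVmx ?block_incoherence_fin //.
  have -> : \matrix_(i, j) (1 *+ (i == j :> nat)) = 1%:M :> 'M[R]_(n_ k).
    by apply/matrixP => i j; rewrite !mxE.
  rewrite mulmxBl -scalemxAl mul1mx -[X in X - _]scale1r -scalerBl norm2Z.
  have -> : 1 - (1 + mu)^-1 = mu / (1 + mu) by field; rewrite gt_eqF.
  by rewrite ger0_norm.
rewrite sub0r mulNmx norm2N -scalemxAl norm2Z ger0_norm ?invr_ge0 ?(ltW mu1) //.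
rewrite [leRHS]mulrAC [leRHS]mulrC ler_wpM2l ?invr_ge0 ?(ltW mu1) //.
apply: le_trans (mulmx_sigma_max _ _) _.
by rewrite ler_wpM2r ?norm2_ge0 // sigma_max_le_incoherence.
Qed.

End Contrast.
End BlockNorms.

(** * Coercive Gram matrices and coherence bounds *)

Section Coercive.
Variables (R : realType) (d : nat).

(** A quadratic form of Gershgorin type: each off-diagonal term is at least
    - nu (x_j^2 + x_j'^2) / 2, so the form is at least
    (1 + nu) |x|^2 - nu d |x|^2. *)
Lemma near_identity_coercive (G : 'M[R]_d) (nu : R) :
  (forall j, G j j = 1) -> (forall j j', j != j' -> `|G j j'| <= nu) ->
  forall x, (1 - (d%:R - 1) * nu) * norm2 x ^+ 2 <= dot x (G *m x).
Proof.
move=> G1 Gnu x.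
(* The diagonal terms x_j^2 are written as (1 + nu) x_j^2 minus the bound used
   off the diagonal, so that a single formula covers all pairs. *)
have termE (j j' : 'I_d) :
    (1 + nu) * x j 0 ^+ 2 * (j == j')%:R - nu * (x j 0 ^+ 2 + x j' 0 ^+ 2) / 2
    <= x j 0 * (G j j' * x j' 0).
  have [<-|jj'] := eqVneq j j'; first by rewrite G1 mulr1; nra.
  have := Gnu _ _ jj'; rewrite ler_norml => /andP[].
  have := sqr_ge0 (x j 0 - x j' 0); have := sqr_ge0 (x j 0 + x j' 0).
  move: (x j 0) (x j' 0) (G j j') => a b g; rewrite mulr0; nra.
have -> : dot x (G *m x) = \sum_j \sum_j' x j 0 * (G j j' * x j' 0).
  by rewrite dotE; apply: eq_bigr => j _; rewrite mxE mulr_sumr.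
have n2 : norm2 x ^+ 2 = \sum_j x j 0 ^+ 2.
  by rewrite norm2_sq dotE; apply: eq_bigr => j _; rewrite expr2.
have sumE : (1 - (d%:R - 1) * nu) * norm2 x ^+ 2 = \sum_j \sum_j'
    ((1 + nu) * x j 0 ^+ 2 * (j == j')%:R - nu * (x j 0 ^+ 2 + x j' 0 ^+ 2) / 2).
  have -> : \sum_j \sum_j' ((1 + nu) * x j 0 ^+ 2 * (j == j')%:R
        - nu * (x j 0 ^+ 2 + x j' 0 ^+ 2) / 2) =
      \sum_j ((1 + nu) * x j 0 ^+ 2
        - nu / 2 * (d%:R * x j 0 ^+ 2 + norm2 x ^+ 2)).
    apply: eq_bigr => j _; rewrite sumrB; congr (_ - _).
      rewrite (bigD1 j) //= eqxx mulr1 big1 ?addr0 // => j' jj'.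
      by rewrite eq_sym (negbTE jj') mulr0.
    rewrite -mulr_suml -mulr_sumr big_split /= -n2 sumr_const card_ord.
    rewrite -[x j 0 ^+ 2 *+ d]mulr_natl.
    by rewrite mulrAC.
  rewrite sumrB -mulr_sumr -mulr_sumr big_split /= -mulr_sumr -n2 sumr_const.
  rewrite card_ord -[norm2 x ^+ 2 *+ d]mulr_natl; by field.
by rewrite sumE; apply: ler_sum => j _; apply: ler_sum => j' _; exact: termE.
Qed.

Lemma coercive_lower_bound (G : 'M[R]_d) (delta : R) :
  (forall x, delta * norm2 x ^+ 2 <= dot x (G *m x)) ->
  forall x, delta * norm2 x <= norm2 (G *m x).
Proof.
move=> Gd x; have [->|] := eqVneq x 0; first by rewrite mulmx0 !norm2_0 mulr0.
rewrite -norm2_gt0 => x0; rewrite -(ler_pM2r x0) -mulrA -expr2.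
by rewrite (le_trans (Gd x)) // mulrC dot_norm2_le.
Qed.

Lemma coercive_unitmx (G : 'M[R]_d) (delta : R) : 0 < delta ->
  (forall x, delta * norm2 x <= norm2 (G *m x)) -> G \in unitmx.
Proof.
move=> d0 Gd; rewrite -unitmx_tr -row_free_unit; apply: inj_row_free => v vG.
apply/eqP; rewrite -trmx_eq0 -norm2_eq0 eq_le norm2_ge0 andbT.
rewrite -(pmulr_rle0 _ d0) (le_trans (Gd _)) //.
by rewrite -[G]trmxK -trmx_mul vG trmx0 norm2_0.
Qed.

End Coercive.

Section Efrac.
Variable R : realType.

(** The form without division covers the convention of an infinite fraction when
    mu = 0. *)
Lemma lt_efrac (mu r : R) : 0 <= mu ->
  (r%:E < efrac (1 + mu) (2 * mu))%E = (2 * mu * r < 1 + mu).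
Proof.
move=> mu0; rewrite /efrac; case: eqVneq => [/eqP|m0].
  by rewrite mulf_eq0 pnatr_eq0 /= => /eqP ->; rewrite ltry mulr0 mul0r addr0 ltr01.
have mp : 0 < 2 * mu by rewrite lt_def m0 mulr_ge0.
by rewrite lte_fin ltr_pdivlMr // mulrC.
Qed.

Lemma efrac_ratio (a b : R) : 0 < a ->
  efrac (1 + b / a) (2 * (b / a)) = efrac (a + b) (2 * b).
Proof.
move=> a0; have a1 : a != 0 by rewrite gt_eqF.
rewrite /efrac mulrA mulf_eq0 invr_eq0 (negbTE a1) orbF.
case: eqVneq => // b0; congr EFin; field.
by rewrite a1 andbT; apply: contra b0 => /eqP ->; rewrite mulr0.
Qed.

End Efrac.

Section EqualBlocks.
Variables (R : realType) (m K : nat) (n_ : 'I_K -> nat).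
Variables (A : 'M[R]_(m, (\sum_(k < K) n_ k)%N)) (d : nat).
Hypothesis nd : forall k, n_ k = d.
Hypothesis A1 : forall j, norm2 (col j A) = 1.
Let delta := 1 - (d%:R - 1) * sub_coherence A.

Lemma gram_diag k j : gram A k j j = 1.
Proof.
rewrite -(expr1n _ 2) -(A1 (tagnat.Rank k j)) norm2_sq dotE /gram mxE.
by apply: eq_bigr => i _; rewrite !mxE.
Qed.

Lemma gram_offdiag k j j' : j != j' -> `|gram A k j j'| <= sub_coherence A.
Proof.
move=> jj'; rewrite /sub_coherence.
apply: (bigmax_sup k) => //; apply: (bigmax_sup j) => //.
apply: (bigmax_sup j') => //; rewrite /gram !mxE.
by rewrite le_eqVlt; apply/orP; left; apply/eqP; congr `|_|;
  apply: eq_bigr => i _; rewrite !mxE.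
Qed.

Lemma gram_lower_bound k x : delta * norm2 x <= norm2 (gram A k *m x).
Proof.
apply: coercive_lower_bound => y; rewrite /delta -(nd k).
by apply: near_identity_coercive => [j|j j']; [exact: gram_diag|exact: gram_offdiag].
Qed.

(** The inverse of C_k has norm at most 1 / delta, delta being the coercivity
    constant, and the block coherence bounds A[k]^T A[l]. *)
Lemma block_incoherence_le : 0 < delta ->
  (block_incoherence A <= (d%:R * block_coherence A d / delta)%:E)%E.
Proof.
move=> d0; rewrite /block_incoherence ifT; last first.
  by apply/forallP => k; exact: coercive_unitmx d0 (@gram_lower_bound k).
set c := \big[_/_]_(k < K) _; rewrite lee_fin.
have sigma_le k l : k != l ->
    sigma_max ((colblock A k)^T *m colblock A l) <= d%:R * block_coherence A d.
  move=> kl; rewrite /block_coherence; set b := \big[_/_]_(_ < K) _.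
  have bge : sigma_max ((colblock A k)^T *m colblock A l) <= b.
    apply: (bigmax_sup k) => //; exact: (le_bigmax_cond _ (fun l =>
      sigma_max ((colblock A k)^T *m colblock A l))).
  have [dz|dn0] := eqVneq d 0%N; last by rewrite mulrA mulfV ?mul1r // pnatr_eq0.
  (* When d = 0 the normalization 1 / d in the block coherence cannot be
     cancelled, but then the blocks are empty. *)
  rewrite [X in X%:R]dz mul0r; apply: sigma_max_le => // x.
  have -> : (colblock A k)^T *m colblock A l *m x = 0.
    by apply/matrixP => i j; case: i => i ilt; exfalso; move: ilt; rewrite nd dz.
  by rewrite norm2_0 mul0r.
have b0 : 0 <= d%:R * block_coherence A d.
  by rewrite /block_coherence !mulr_ge0 ?invr_ge0 ?ler0n //; exact: bigmax_ge_id.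
have b1 : 0 <= d%:R * block_coherence A d / delta by rewrite divr_ge0 // ltW.
apply: bigmax_le => // k _; apply: bigmax_le => // l kl.
apply: sigma_max_le => // x; rewrite mulrAC ler_pdivlMr // mulrC.
have := @gram_lower_bound k (invmx (gram A k) *m (colblock A k)^T *m colblock A l *m x).
move=> /le_trans; apply.
rewrite -!(mulmxA (invmx _)) mulKVmx; last first.
  exact: coercive_unitmx d0 (@gram_lower_bound k).
apply: le_trans (mulmx_sigma_max _ _) _.
by rewrite ler_wpM2r ?norm2_ge0 // sigma_le.
Qed.

End EqualBlocks.

(** * Mutual block-incoherence and the condition Q *)

Theorem proposition5p4 (R : realType) (m K : nat) (n_ : 'I_K -> nat)
    (A : 'M[R]_(m, (\sum_(k < K) n_ k)%N)) (s : nat)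
    (s_gt0 : (0 < s)%N) (s_leK : (s <= K)%N) :
  let mu := fine (block_incoherence A) in
  let H := contrast A mu in
  (* (i) *)
  ((block_incoherence A < +oo)%E ->
    let V := 1%:M - H^T *m A in
    let kappa := mu * s%:R / (1 + mu) in
    [/\ 1%:M = V + H^T *m A,
        \big[Num.max/0]_(k < K) \big[Num.max/0]_(l < K)
          sigma_max (submxblock V k l) <= s%:R^-1 * kappa
      & (s%:R%:E < efrac (1 + mu) (2 * mu))%E ->
        condQ A s kappa H (L (n_ := n_) +oo%E) /\ kappa < 1 / 2])
  /\
  (* (ii) *)
  (forall d : nat,
    (forall k, n_ k = d) ->
    (forall j, norm2 (col j A) = 1) ->
    let nu := sub_coherence A in
    let muB := block_coherence A d in
    let chi := efrac (1 - (d%:R - 1) * nu + d%:R * muB) (2 * d%:R * muB) in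
    0 < 1 - (d%:R - 1) * nu ->
    (s%:R%:E < chi)%E ->
    let mubar := d%:R * muB / (1 - (d%:R - 1) * nu) in
    [/\ (block_incoherence A <= mubar%:E)%E,
        efrac (1 + mubar) (2 * mubar) = chi,
        (s%:R%:E < efrac (1 + mu) (2 * mu))%E
      & exists kappa : R,
          kappa < 1 / 2 /\ condQ A s kappa H (L (n_ := n_) +oo%E)]).
Proof.
move=> mu H.
have mu0 : 0 <= mu := block_incoherence_ge0 A.
have s0 : 0 < s%:R :> R by rewrite ltr0n.
have s1 : 1 <= s%:R :> R by rewrite ler1n.
have mu1 : 0 < 1 + mu by rewrite ltr_pwDl.
have kappaE : s%:R^-1 * (mu * s%:R / (1 + mu)) = mu / (1 + mu).
  by field; rewrite !gt_eqF.
have part_i : (block_incoherence A < +oo)%E ->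
    (s%:R%:E < efrac (1 + mu) (2 * mu))%E ->
    condQ A s (mu * s%:R / (1 + mu)) H (L (n_ := n_) +oo%E) /\
    mu * s%:R / (1 + mu) < 1 / 2.
  move=> Afin; rewrite lt_efrac // => slt; split.
    apply: condQ_of_blocks => [|k l]; first by rewrite divr_ge0 ?mulr_ge0 // ltW.
    by rewrite kappaE; exact: sigma_max_contrast_residual.
  by rewrite ltr_pdivrMr //; lra.
split=> [Afin V kappa|d nd A1 nu muB chi delta0 slt mubar].
  split; first by rewrite subrK.
    rewrite kappaE; have c0 : 0 <= mu / (1 + mu) by rewrite divr_ge0 // ltW.
    apply: bigmax_le => // k _; apply: bigmax_le => // l _.
    exact: sigma_max_contrast_residual.
  exact: part_i.
have muleb : (block_incoherence A <= mubar%:E)%E by exact: block_incoherence_le.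
have Afin : (block_incoherence A < +oo)%E := le_lt_trans muleb (ltry _).
have chiE : efrac (1 + mubar) (2 * mubar) = chi.
  by rewrite efrac_ratio // /chi mulrA.
have mule : mu <= mubar.
  move: Afin muleb; rewrite /mu /block_incoherence.
  by case: ifP => //= _ _; rewrite lee_fin.
have smu : (s%:R%:E < efrac (1 + mu) (2 * mu))%E.
  move: slt; rewrite -chiE !lt_efrac // ?(le_trans mu0) //; nra.
split=> //; exists (mu * s%:R / (1 + mu)).
by have [] := part_i Afin smu.
Qed.
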